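(* Let $n\ge 1$. For every $321$-avoiding permutation $\pi\in S_n$, $\mathrm{weakbump}(\pi)=\mathrm{bump}(\pi)$.
   Context: $S_n$ is the set of permutations $\pi=\pi_1\cdots\pi_n$ (one-line notation) of $\{1,\ldots,n\}$. A permutation is $321$-avoiding if there are no indices $a<b<c$ with $\pi_a>\pi_b>\pi_c$. Robinson–Schensted (RS) correspondence: tableaux are fillings of Young diagrams with distinct positive integers increasing along rows and down columns. To insert $k$ into a tableau $P$ (written $P\leftarrow k$), start with the top row: (I1) if $k$ is greater than or equal to the rightmost entry of the current row, or the current row is empty, append $k$ at the end of that row and stop; (I2) otherwise let $y$ be the leftmost entry of the current row with $k<y$, replace $y$ by $k$ (this is one bump), set $k:=y$, move down one row and go to (I1). For $\pi\in S_n$, let $P_0$ be the empty tableau and $P_i=P_{i-1}\leftarrow\pi_i$ for $1\le i\le n$. Let $\mathrm{bump}_i(\pi)$ be the number of bumps that occur during the insertion $P_{i-1}\leftarrow\pi_i$, and $\mathrm{bump}(\pi)=\sum_{i=1}^n\mathrm{bump}_i(\pi)$ the total number of bumps. Let $\mathrm{weakbump}_i(\pi)=1$ if $\mathrm{bump}_i(\pi)>0$ and $0$ otherwise, and $\mathrm{weakbump}(\pi)=\sum_{i=1}^n\mathrm{weakbump}_i(\pi)$. *)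

(* Defs.v *)
From mathcomp Require Import all_boot all_fingroup.

Set Implicit Arguments.
Unset Strict Implicit.
Unset Printing Implicit Defensive.

(* A filling of a Young diagram, as the sequence of its rows from top to
   bottom.  Row insertion is defined on all such sequences; rows and columns
   increase in the tableaux it produces from distinct entries. *)
Definition tableau := seq (seq nat).

(* [insertion P k] is the pair of the tableau P <- k and the number of bumps
   made in forming it. *)
Fixpoint insertion (P : tableau) (k : nat) : tableau * nat :=
  if P is row :: P' then
    if nilp row || (last 0 row <= k) then (rcons row k :: P', 0)
    else
      let j := find (fun y => k < y) row in
      let: (Q, b) := insertion P' (nth 0 row j) in
      (set_nth 0 row j k :: Q, b.+1)
  else ([:: [:: k]], 0).

Definition insert (P : tableau) (k : nat) : tableau := (insertion P k).1.
Definition nbumps (P : tableau) (k : nat) : nat := (insertion P k).2.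

Section Permutations.

Variables (n : nat) (pi : 'S_n).

(* 'S_n permutes {0, ..., n-1}; the letters are shifted to {1, ..., n}. *)
Definition letter (i : 'I_n) : nat := (pi i).+1.

Definition one_line : seq nat := [seq letter i | i <- enum 'I_n].

Definition avoids321 : bool :=
  ~~ [exists a : 'I_n, exists b : 'I_n, exists c : 'I_n,
        [&& a < b, b < c, letter b < letter a & letter c < letter b]].

Definition RS_tableau (i : nat) : tableau :=
  foldl insert [::] (take i one_line).

(* Positions are counted from 0: the letter at position i is the (i+1)-st one
   and is inserted into the tableau of the i letters before it. *)
Definition bump_at (i : 'I_n) : nat := nbumps (RS_tableau i) (letter i).

Definition weakbump_at (i : 'I_n) : nat := if 0 < bump_at i then 1 else 0.

Definition total_bump : nat := \sum_(i < n) bump_at i.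

Definition total_weakbump : nat := \sum_(i < n) weakbump_at i.

End Permutations.

(* Main.v *)
Require Import Defs.
From mathcomp Require Import all_boot all_fingroup.

Set Implicit Arguments.
Unset Strict Implicit.
Unset Printing Implicit Defensive.

(** The two statistics agree as soon as no insertion makes two bumps, and that
    is what avoiding 321 forces; it also keeps the tableau within two rows.
    Suppose that inserting [k] after the word [s] bumps [z] out of the first row,
    and that [z] then bumps some entry of the second row, whose last entry [y] is
    therefore larger than [z].

    - If [z] was inserted after [y], then [y], [z], [k] is a 321.
    - If [z] was inserted before [y], then [z] stood in the first row when some
      letter [x] bumped [y]; as [y] was the leftmost entry above [x], we have
      [z <= x < y], and [y], [x], [k] is a 321.

    Both cases are covered by one property: whenever [z < y] with [z] in the
    first row and [y] in the second, some [x] with [z <= x < y] follows [y] in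
    [s].  [separated_insert] shows that insertion preserves it, and
    [separated_append2] that it excludes a second bump.  The argument applies to
    all words, repeated letters included; [avoids321_one_line] specializes it to
    permutations. *)

Definition avoids321_word (w : seq nat) : Prop :=
  forall a b c, subseq [:: a; b; c] w -> b < a -> c < b -> False.

(** The two rows are read off with default [[::]], so that tableaux with fewer
    than two rows need no separate treatment. *)
Record separated (s : seq nat) (P : tableau) : Prop := Separated {
  separated_size : size P <= 2;
  separated_sorted : pairwise leq (nth [::] P 0);
  separated_row1 : {subset nth [::] P 0 <= s};
  separated_row2 : {subset nth [::] P 1 <= s};
  separated_witness : forall y z,
    y \in nth [::] P 1 -> z \in nth [::] P 0 -> z < y ->
    exists x, [/\ subseq [:: y; x] s, z <= x & x < y]
}.

Lemma avoids321_word_subseq v w :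
  subseq v w -> avoids321_word w -> avoids321_word v.
Proof. by move=> vw avw a b c /subseq_trans - /(_ _ vw); apply: avw. Qed.

Lemma subseq2_rcons (s : seq nat) y k :
  y \in s -> subseq [:: y; k] (rcons s k).
Proof. by move=> ys; rewrite -cats1 -cat1s cat_subseq ?sub1seq ?mem_head. Qed.

Lemma pairwise_leq_last row k :
  pairwise leq row -> last 0 row <= k -> all (leq^~ k) row.
Proof.
case/lastP: row => // row l; rewrite pairwise_rcons last_rcons all_rcons.
case/andP=> /allP le_l _ lk; rewrite lk; apply/allP => z /le_l /= zl.
exact: leq_trans lk.
Qed.

(** The bumping step as a decomposition of the row around the bumped entry [y],
    which is easier to reason about than [find] and [set_nth]. *)
Lemma insertion_bump row (P : tableau) k :
  ~~ (nilp row || (last 0 row <= k)) ->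
  exists A y B, [/\ row = A ++ y :: B, all (leq^~ k) A, k < y &
    insertion (row :: P) k
      = ((A ++ k :: B) :: insert P y, (nbumps P y).+1)].
Proof.
move=> bump; have := bump; rewrite negb_or -ltnNge => /andP[row_neq0 k_last].
have hask : has (fun y => k < y) row.
  apply/hasP; exists (last 0 row) => //.
  by case: (row) row_neq0 => //= a r _; apply: mem_last.
rewrite /= (negbTE bump) /insert /nbumps.
case: (split_find_nth 0 hask) => y A B ky noA.
rewrite cat_rcons; exists A, y, B; split=> //.
  apply/allP => z zA; rewrite leqNgt; apply: contra noA => kz.
  by apply/hasP; exists z.
have find_j : find (fun y => k < y) (A ++ y :: B) = size A.
  by rewrite find_cat (negbTE noA) /= ky addn0.
rewrite find_j.
case: (insertion P y) => Q b /=; congr ((_ :: _), _).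
by elim: A {noA find_j} => //= a A ->.
Qed.

(** The entry [y] bumped from the first row goes to the end of the second row:
    if the last entry of that row exceeded [y], then this entry, the witness [x]
    that follows it in [s], and [k] would form a 321. *)
Lemma separated_append2 s A y B (P : tableau) k :
  separated s ((A ++ y :: B) :: P) -> avoids321_word (rcons s k) -> k < y ->
  insertion P y = ([:: rcons (nth [::] P 0) y], 0).
Proof.
case=> size_P _ _ _ wit av ky; case: P size_P wit => [//|R [|//]] _ /= wit.
case: nilP => [-> //|/eqP R_neq0] /=.
have lastR : last 0 R \in R by case: (R) R_neq0 => //= a r _; apply: mem_last.
case: leqP => // y_last; exfalso.
have yA : y \in A ++ y :: B by rewrite mem_cat mem_head orbT.
have [x [sub_x yx x_last]] := wit _ _ lastR yA y_last.
apply: (av (last 0 R) x k) => //; last exact: leq_trans yx.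
by rewrite -(cats1 s) -[[:: _; _; _]]/([:: last 0 R; x] ++ [:: k]) cat_subseq.
Qed.

Lemma separated_nbumps s P k :
  separated s P -> avoids321_word (rcons s k) -> nbumps P k <= 1.
Proof.
case: P => [//|row P] sep av; rewrite /nbumps.
have [append|/(@insertion_bump _ P)] := boolP (nilp row || (last 0 row <= k)).
  by rewrite /= append.
move=> [A [y [B [def_row _ ky ->]]]]; rewrite def_row in sep.
by rewrite /= /nbumps (separated_append2 sep av ky).
Qed.

(** The new letter [k] is itself the witness for all new pairs: it follows every
    letter of [s], and if it bumps [y] then the entries of the first row below
    [y] are exactly those at most [k]. *)
Lemma separated_insert s P k :
  separated s P -> avoids321_word (rcons s k) ->
  separated (rcons s k) (insert P k).
Proof.
have s_rcons : {subset s <= rcons s k} by apply: mem_subseq; apply: subseq_rcons.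
have k_rcons : k \in rcons s k by rewrite mem_rcons mem_head.
have old_witness y z :
    (exists x, [/\ subseq [:: y; x] s, z <= x & x < y]) ->
    exists x, [/\ subseq [:: y; x] (rcons s k), z <= x & x < y].
  case=> x [sub_x zx xy]; exists x; split=> //.
  exact: subseq_trans sub_x (subseq_rcons _ _).
case: P => [_ _|row P sep av].
  by split=> //= z; rewrite inE => /eqP->.
rewrite /insert.
have [append|/(@insertion_bump _ P)] := boolP (nilp row || (last 0 row <= k)).
  rewrite /= append; case: sep => /= size_P srt r1 r2 wit; split=> //=.
  - rewrite pairwise_rcons srt andbT.
    by case/orP: append => [/nilP->//|]; apply: pairwise_leq_last.
  - by move=> z; rewrite mem_rcons inE => /predU1P[->//|/r1/s_rcons].
  - by move=> y /r2/s_rcons.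
  move=> y z yP; rewrite mem_rcons inE => /predU1P[->|zrow] zy.
    by exists k; split=> //; apply/subseq2_rcons/r2.
  by apply/old_witness/wit.
move=> [A [y [B [def_row Ak ky ->]]]]; rewrite def_row {row def_row} in sep *.
rewrite /insert (separated_append2 sep av ky).
case: sep => /= size_P srt r1 r2 wit.
have sub_row z : z \in A ++ k :: B -> z = k \/ z \in A ++ y :: B.
  by rewrite !mem_cat !inE => /or3P[->|/eqP->|->]; rewrite ?orbT; auto.
have ys : y \in s by apply: r1; rewrite mem_cat mem_head orbT.
move: (srt); rewrite pairwise_cat /= allrel_consr.
case/and4P=> /andP[Ay AB] pA yB pB.
split=> //=.
- rewrite pairwise_cat /= allrel_consr Ak AB pA pB !andbT /=.
  by apply: (sub_all _ yB) => z; apply: leq_trans (ltnW ky).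
- by move=> z /sub_row[->//|/r1/s_rcons].
- by move=> z; rewrite mem_rcons inE => /predU1P[->|/r2]; apply: s_rcons.
move=> v z; rewrite mem_rcons inE => /predU1P[->|vR] zrow zv.
  exists k; split=> //; first exact: subseq2_rcons.
  move: zrow; rewrite mem_cat inE => /or3P[/(allP Ak)|/eqP->|] //.
  by move/(allP yB) => /=; rewrite leqNgt zv.
have [zk|zrow'] := sub_row _ zrow; last by apply/old_witness/wit.
by rewrite zk in zv *; exists k; split=> //; apply/subseq2_rcons/r2.
Qed.

Lemma separated_foldl_insert s :
  avoids321_word s -> separated s (foldl insert [::] s).
Proof.
elim/last_ind: s => [|s k IHs] av; first by split.
rewrite foldl_rcons; apply: separated_insert => //; apply: IHs.
exact: avoids321_word_subseq (subseq_rcons s k) av.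
Qed.

Lemma avoids321_one_line n (pi : 'S_n) :
  avoids321 pi -> avoids321_word (one_line pi).
Proof.
move=> av a b c /subseqP[m _]; rewrite /one_line -map_mask.
have : sorted ltn (map val (mask m (enum 'I_n))).
  apply: (subseq_sorted ltn_trans _ (iota_ltn_sorted 0 n)).
  by rewrite -val_enum_ord map_subseq ?mask_subseq.
case: (mask m _) => [|i [|j [|l [|? ?]]]] //= /and3P[ij jl _] [-> -> ->] ba cb.
move/negP: av; apply; apply/existsP; exists i; apply/existsP; exists j.
by apply/existsP; exists l; apply/and4P.
Qed.

Lemma bump_at_le1 n (pi : 'S_n) (i : 'I_n) : avoids321 pi -> bump_at pi i <= 1.
Proof.
move/avoids321_one_line => av; rewrite /bump_at /RS_tableau.
have size_w : size (one_line pi) = n by rewrite size_map size_enum_ord.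
have take_i : rcons (take i (one_line pi)) (letter pi i)
    = take i.+1 (one_line pi).
  rewrite (take_nth 0) ?size_w // (nth_map i) ?size_enum_ord //.
  by rewrite nth_ord_enum.
apply: (@separated_nbumps (take i (one_line pi))).
  apply: separated_foldl_insert.
  exact: avoids321_word_subseq (take_subseq _ _) av.
by rewrite take_i; apply: avoids321_word_subseq (take_subseq _ _) av.
Qed.

Theorem proposition19 (n : nat) (hn : 1 <= n) (pi : 'S_n) (hpi : avoids321 pi) :
  total_weakbump pi = total_bump pi.
Proof.
apply: eq_bigr => i _; rewrite /weakbump_at.
by case: (bump_at pi i) (bump_at_le1 i hpi) => [|[]].
Qed.
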